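(* Let $b \ge 2$ be an integer and let $x_n$ be the base $b$ van der Corput sequence, and let $S(N) = \sum_{n=0}^{N-1} \left( \frac{1}{2} - x_n \right)$. For any integer $M > b$ and any real number $\lambda \ge 3$ we have \[ \frac{1}{M} \left| \left\{ 0 \le N < M : \left| S(N) - \frac{b^2-1}{12 b} \log_b M \right| \ge 25 \lambda b \sqrt{\log_b M +1} \right\} \right| \le \frac{4 \sqrt{\lambda}}{e^{\sqrt{\lambda}-1}-2} + \frac{1}{b^{\sqrt{\log_b M} -2}} . \]
   Context: For an integer $b \ge 2$, the base $b$ van der Corput sequence $(x_n)_{n\ge 0}$ is defined as follows: if $n = \sum_{i=1}^m a_i b^{i-1}$ with digits $a_i \in \{0,1,\dots,b-1\}$, then $x_n = \sum_{i=1}^m a_i b^{-i}$. *)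

(* Defs.v *)
(* MathComp-Analysis: the real numbers are an arbitrary [R : realType]. *)
From HB Require Import structures.
From mathcomp Require Import all_boot all_order all_algebra.
From mathcomp Require Import reals exp.

Set Implicit Arguments.
Unset Strict Implicit.
Unset Printing Implicit Defensive.

Import Order.TTheory GRing.Theory Num.Theory.
Local Open Scope ring_scope.

Definition digit (b n i : nat) : nat := ((n %/ b ^ i) %% b)%N.

(* For 2 <= b one has n < b ^ n, so all base-b digits of n sit at positions
   i < n.  Positions start at 0 here, whence the exponent i.+1; the value does
   not depend on leading zeros (see [vdcE]). *)
Definition vdc (R : realType) (b n : nat) : R :=
  \sum_(i < n) (digit b n i)%:R / b%:R ^+ i.+1.

Definition vdcS (R : realType) (b N : nat) : R :=
  \sum_(0 <= n < N) (1 / 2 - vdc R b n).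

Definition logb (R : realType) (b : nat) (x : R) : R := ln x / ln b%:R.

Lemma digit_small b n i : (n < b ^ i)%N -> digit b n i = 0%N.
Proof. by move=> h; rewrite /digit divn_small // mod0n. Qed.

Lemma vdc_widen (R : realType) b n m : (n < b ^ m)%N -> (1 < b)%N ->
  vdc R b n = \sum_(i < m) (digit b n i)%:R / b%:R ^+ i.+1.
Proof.
move=> nm b1.
pose F i : R := (digit b n i)%:R / b%:R ^+ i.+1.
have F0 k i : (n < b ^ k)%N -> (k <= i)%N -> F i = 0.
  move=> nk ki; rewrite /F digit_small ?mul0r //.
  by apply: leq_trans nk _; rewrite leq_pexp2l // ltnW.
have sumF k : (n < b ^ k)%N ->
    \sum_(0 <= i < k) F i = \sum_(0 <= i < maxn n m) F i.
  move=> nk; have [kl|lk] := leqP k (maxn n m).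
    rewrite (big_cat_nat (n := k) (p := maxn n m)) //=.
    rewrite [X in _ = _ + X]big_nat [X in _ = _ + X]big1 ?addr0 // => i.
    by case/andP => ki _; exact: F0 nk ki.
  rewrite (big_cat_nat (n := maxn n m) (p := k)) ?(ltnW lk) //=.
  rewrite [X in _ + X]big_nat [X in _ + X]big1 ?addr0 // => i /andP[+ _].
  by rewrite geq_max => /andP[_ mi]; exact: F0 nm mi.
by rewrite /vdc -!(big_mkord xpredT F) (sumF n) ?(sumF m) // ltn_expl.
Qed.

Lemma ltn_digits b m (a : nat -> nat) : (forall i, (a i < b)%N) ->
  (\sum_(i < m) a i * b ^ i < b ^ m)%N.
Proof.
move=> ab; elim: m => [|m IH]; first by rewrite big_ord0.
rewrite big_ord_recr /= -ltnS expnS -addSn.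
apply: leq_trans (_ : b ^ m + a m * b ^ m < (b * b ^ m).+1)%N.
  by rewrite ltnS leq_add2r.
by rewrite ltnS -mulSn leq_mul2r ab orbT.
Qed.

Lemma digitE b m (a : nat -> nat) j : (forall i, (a i < b)%N) -> (j < m)%N ->
  digit b (\sum_(i < m) a i * b ^ i) j = a j.
Proof.
move=> ab; have b0 : (0 < b)%N by exact: leq_ltn_trans (ab 0%N).
elim: j m a ab => [|j IH] [//|m] a ab jm.
  rewrite /digit big_ord_recl /= expn0 muln1 divn1.
  under eq_bigr do rewrite expnS mulnCA mulnC.
  by rewrite -big_distrl /= addnC modnMDl modn_small.
rewrite -(IH m (fun i => a i.+1)) // /digit expnS divnMA; congr (_ %/ _ %% _)%N.
rewrite big_ord_recl /= expn0 muln1.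
under eq_bigr do rewrite expnS mulnCA mulnC.
by rewrite -big_distrl /= addnC divnMDl // divn_small ?addn0.
Qed.

Lemma vdcE (R : realType) b m (a : nat -> nat) :
  (1 < b)%N -> (forall i, (a i < b)%N) ->
  vdc R b (\sum_(i < m) a i * b ^ i) = \sum_(i < m) (a i)%:R / b%:R ^+ i.+1.
Proof.
move=> b1 ab; rewrite (vdc_widen _ (ltn_digits m ab) b1).
by apply: eq_bigr => i _; rewrite digitE.
Qed.

(* Main.v *)
(* Appending a base-b digit a to N maps x_N to (a + x_N) / b, so the digits of N
   drive a Markov chain along which S is additive.  Correcting S by the
   coboundary (1/2 - x_N)/2 makes the increments, after subtraction of
   (b^2 - 1)/(12 b), centred over a and bounded by b/2.  This bounds the
   exponential moments over 0 <= N < M for M with k digits (also when M is not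
   a power of b), and Chernoff's bound with parameter of order 1/(b sqrt k)
   gives a tail 8 exp(1/2 - 12 lambda), already below the first term on the
   right-hand side. *)
Require Import Defs.
From HB Require Import structures.
From mathcomp Require Import all_boot all_order all_algebra.
From mathcomp Require Import reals sequences exp.
From mathcomp Require Import ring lra.

Import Order.TTheory GRing.Theory Num.Theory.
Local Open Scope ring_scope.

(** * Effect of appending a digit on the sequence and its sums *)

Lemma natr_gt0_of_gt1 (R : realType) b : (1 < b)%N -> 0 < b%:R :> R.
Proof. by move=> b1; rewrite ltr0n ltnW. Qed.

Lemma vdc0 (R : realType) b : vdc R b 0 = 0.
Proof. by rewrite /vdc big_ord0. Qed.

Lemma vdc_step (R : realType) b n a : (1 < b)%N -> (a < b)%N ->
  vdc R b (b * n + a) = (a%:R + vdc R b n) / b%:R.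
Proof.
move=> b1 ab; have b0 : (0 < b)%N := ltnW b1.
have nb : (n < b ^ n)%N by exact: ltn_expl.
have nab : (b * n + a < b ^ n.+1)%N.
  apply: (@leq_trans (b * n.+1)); first by rewrite mulnS addnC ltn_add2r.
  by rewrite expnS leq_mul2l nb orbT.
rewrite (vdc_widen R nab b1) /vdc big_ord_recl /= expr1 mulrDl; congr (_ / _ + _).
  by rewrite /digit expn0 divn1 mulnC modnMDl modn_small.
rewrite mulr_suml; apply: eq_bigr => i _.
rewrite /digit /bump /= add1n expnS divnMA mulnC divnMDl // (divn_small ab) addn0.
by rewrite exprSr invfM mulrA.
Qed.

Lemma vdc_itv (R : realType) b n : (1 < b)%N -> 0 <= vdc R b n <= 1.
Proof.
move=> b1; have b0 := natr_gt0_of_gt1 R b b1.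
elim/ltn_ind: n => -[|n] IH; first by rewrite vdc0 lexx ler01.
rewrite (divn_eq n.+1 b) mulnC vdc_step ?ltn_pmod ?(ltnW b1) //.
have /andP[y0 y1] := IH _ (ltn_Pdiv b1 (ltn0Sn n)).
rewrite divr_ge0 ?addr_ge0 ?ler0n //= ler_pdivrMr // mul1r.
have : (n.+1 %% b).+1%:R <= b%:R :> R by rewrite ler_nat ltn_pmod ?(ltnW b1).
rewrite -natr1; lra.
Qed.

Lemma vdcSS (R : realType) b n : vdcS R b n.+1 = vdcS R b n + (1 / 2 - vdc R b n).
Proof. by rewrite /vdcS big_nat_recr. Qed.

(** The [a] added terms are [(j + x_n) / b] for [j < a], an arithmetic progression. *)
Lemma vdcS_block (R : realType) b n a : (1 < b)%N -> (a <= b)%N ->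
  vdcS R b (b * n + a) = vdcS R b (b * n)
    + (a%:R / 2 - a%:R * (a%:R - 1) / (2 * b%:R) - a%:R * vdc R b n / b%:R).
Proof.
move=> b1; have b0 := lt0r_neq0 (natr_gt0_of_gt1 R b b1).
elim: a => [|a IH] ab; first by rewrite addn0; field.
by rewrite addnS vdcSS IH ?(ltnW ab) // vdc_step // -natr1; field.
Qed.

(** A full block of [b] terms contributes [b/2 - (b-1)/2 - x_n], which is the single term
    [1/2 - x_n]. *)
Lemma vdcS_mul (R : realType) b n : (1 < b)%N -> vdcS R b (b * n) = vdcS R b n.
Proof.
move=> b1; have b0 := lt0r_neq0 (natr_gt0_of_gt1 R b b1).
elim: n => [|n IH]; first by rewrite muln0.
by rewrite mulnSr vdcS_block // IH vdcSS; field.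
Qed.

(* Average of [vdcS R b n] and [vdcS R b n.+1]: the increments of this
   corrected sum along the base-b digits of [n] are centred. *)
Definition vdcW (R : realType) b n : R := vdcS R b n + (1 / 2 - vdc R b n) / 2.

(** The average of [a (b - a) / (2 b)] over the digits [a < b]. *)
Definition vdc_mean (R : realType) b : R := (b%:R ^+ 2 - 1) / (12 * b%:R).

(** Centred increment of [vdcW] when the digit [a] is appended to a number with van der Corput value
    [y]. The correction in [vdcW] gives [y] a coefficient that sums to zero over [a]. *)
Definition vdc_incr (R : realType) b (y : R) a : R :=
  (a%:R * (b%:R - a%:R) / 2 - (b%:R ^+ 2 - 1) / 12
   + y * (b%:R - 1 - 2 * a%:R) / 2) / b%:R.

Lemma vdcW_step (R : realType) b n a : (1 < b)%N -> (a < b)%N ->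
  vdcW R b (b * n + a) =
  vdcW R b n + vdc_mean R b + vdc_incr R b (vdc R b n) a.
Proof.
move=> b1 ab; have b0 := lt0r_neq0 (natr_gt0_of_gt1 R b b1).
rewrite /vdcW vdcS_block ?(ltnW ab) // vdcS_mul // vdc_step //.
by rewrite /vdc_mean /vdc_incr; field.
Qed.

Lemma vdc_incr_sum (R : realType) b y : (1 < b)%N ->
  \sum_(a < b) vdc_incr R b y a = 0.
Proof.
move=> b1; have b0 := lt0r_neq0 (natr_gt0_of_gt1 R b b1).
(* Closed form of the partial sums with [b] fixed, so that induction on [n] applies; the factor
   [b - n] vanishes at [n = b]. *)
suff sumE n : \sum_(a < n) vdc_incr R b y a = n%:R * (b%:R - n%:R) *
    ((2 * n%:R - 3 - b%:R) / 12 + y / 2) / b%:R by rewrite sumE subrr mulr0 !mul0r.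
elim: n => [|n IH]; first by rewrite big_ord0 !mul0r.
by rewrite big_ord_recr /= IH /vdc_incr -natr1; field.
Qed.

Lemma vdc_incr_bound (R : realType) b y a : (1 < b)%N -> (a < b)%N -> 0 <= y <= 1 ->
  `|vdc_incr R b y a| <= b%:R / 2.
Proof.
move=> b1 ab /andP[y0 y1]; have b0 := natr_gt0_of_gt1 R b b1.
rewrite /vdc_incr normrM normfV (gtr0_norm b0) ler_pdivrMr //.
have b2 : 2 <= b%:R :> R by rewrite (ler_nat _ 2).
have a0 : 0 <= a%:R :> R by [].
have a1 : a%:R + 1 <= b%:R :> R by rewrite natr1 ler_nat.
move: {b1 ab b0} (b%:R : R) (a%:R : R) b2 a0 a1 => B A b2 a0 a1.
have h1 : 0 <= A * (B - A) by apply: mulr_ge0 => //; lra.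
have h2 : A * (B - A) <= B ^+ 2 / 4.
  by rewrite -subr_ge0 (_ : _ - _ = (B / 2 - A) ^+ 2) ?sqr_ge0 //; field.
have h3 : 4 <= B ^+ 2 by nra.
have h4 : B * 2 <= B ^+ 2 by nra.
have h5 : `|y * (B - 1 - 2 * A)| <= B - 1.
  rewrite normrM (ger0_norm y0) -[leRHS]mul1r; apply: ler_pM => //.
  by rewrite ler_norml; apply/andP; split; lra.
move: h5; rewrite !ler_norml => /andP[h5 h6]; apply/andP; split; lra.
Qed.

(** The value at 0 is 1/4, and each of the [k] digits, leading zeros included, moves the centred
    value by at most [b/2]. *)
Lemma vdcW_bound (R : realType) b k n : (1 < b)%N -> (n < b ^ k)%N ->
  `|vdcW R b n - k%:R * vdc_mean R b| <= 1 / 4 + k%:R * (b%:R / 2).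
Proof.
move=> b1; elim: k n => [|k IH] n nk.
  move: nk; rewrite expn0 ltnS leqn0 => /eqP ->.
  rewrite /vdcW vdc0 /vdcS big_geq // !mul0r ger0_norm; lra.
have b0 := ltnW b1.
have rb : (n %% b < b)%N by rewrite ltn_pmod.
have nE : n = (b * (n %/ b) + n %% b)%N by rewrite mulnC -divn_eq.
rewrite nE vdcW_step //.
have := IH (n %/ b)%N; rewrite ltn_divLR // -expnSr => /(_ nk).
have := vdc_incr_bound R b (vdc R b (n %/ b)) (n %% b) b1 rb (vdc_itv R b _ b1).
rewrite -natr1 !ler_norml => /andP[? ?] /andP[? ?]; apply/andP; split; lra.
Qed.

(** * Block summation and elementary bounds on the exponential *)

Lemma sum_nat_block (R : realType) (f : nat -> R) b q r :
  \sum_(n < b * q + r) f n =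
  \sum_(n < q) \sum_(a < b) f (b * n + a)%N + \sum_(a < r) f (b * q + a)%N.
Proof.
rewrite big_split_ord /=; congr (_ + _).
elim: q => [|q IH]; first by rewrite muln0 !big_ord0.
by rewrite big_ord_recr /= -IH mulnSr big_split_ord.
Qed.

Lemma expR_le_inv (R : realType) (x : R) : x < 1 -> expR x <= (1 - x)^-1.
Proof.
move=> x1; rewrite -[x in expR x]opprK expRN lef_pV2 ?posrE ?expR_gt0 //; last by lra.
by have := expR_ge1Dx (- x); lra.
Qed.

Lemma expR_quadratic (R : realType) (x : R) : x <= 1 / 2 ->
  expR x <= 1 + x + 2 * x ^+ 2.
Proof.
move=> x1; apply: le_trans (expR_le_inv R x _) _; first by lra.
rewrite -[leLHS]mul1r ler_pdivrMr; last by lra.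
(* Multiplying out, [(1 - x)(1 + x + 2 x^2) = 1 + x^2 (1 - 2 x)]. *)
rewrite -subr_ge0 (_ : _ - _ = x ^+ 2 * (1 - 2 * x)); last by ring.
by apply: mulr_ge0; [exact: sqr_ge0|lra].
Qed.

(** * Exponential moments of the centred [vdcW] *)

Section ExponentialMoment.
Variables (R : realType) (b : nat) (s : R).
Hypotheses (b1 : (1 < b)%N) (s_small : `|s| * (b%:R / 2) <= 1 / 4).

Let c : R := b%:R / 2.
(** Growth factors of the weight [w] per digit: [q] in the worst case, [rho] on average over the
    digit. *)
Let q : R := expR (`|s| * c).
Let rho : R := 1 + 2 * (s * c) ^+ 2.
Let w (k n : nat) : R := expR (s * (vdcW R b n - k%:R * vdc_mean R b)).

Let c_ge0 : 0 <= c. Proof. by rewrite /c divr_ge0. Qed.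

Let q_ge1 : 1 <= q.
Proof. by rewrite /q -expR0 ler_expR mulr_ge0. Qed.

Let q_le : q <= 4 / 3.
Proof.
apply: le_trans (_ : expR (1 / 4) <= _); first by rewrite ler_expR.
apply: le_trans (expR_le_inv R _ _) _; first by lra.
by rewrite (_ : (1 - 1 / 4)^-1 = 4 / 3 :> R); last by field.
Qed.

Let rho_ge1 : 1 <= rho.
Proof. by rewrite /rho lerDl mulr_ge0 ?sqr_ge0. Qed.

Lemma vdc_expR_sup k n : (n < b ^ k)%N -> w k n <= expR (`|s| / 4) * q ^+ k.
Proof.
move=> nk; rewrite /w /q -expRM_natl -expRD ler_expR.
apply: le_trans (ler_norm _) _; rewrite normrM.
apply: le_trans (ler_wpM2l (normr_ge0 s) (vdcW_bound R b k n b1 nk)) _.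
rewrite -/c -mulr_natl; lra.
Qed.

(** Given [n], the increments sum to zero over the last digit, so the linear term of
    [expR_quadratic] cancels and only the quadratic one enters [rho]. *)
Lemma vdc_expR_sum_block k n :
  \sum_(a < b) w k.+1 (b * n + a)%N <= b%:R * rho * w k n.
Proof.
pose D a := vdc_incr R b (vdc R b n) a.
have wE (a : 'I_b) : w k.+1 (b * n + a)%N = w k n * expR (s * D a).
  by rewrite /w -expRD vdcW_step // -natr1 -/(D a); congr expR; ring.
rewrite (eq_bigr _ (fun a _ => wE a)) -mulr_sumr mulrC ler_wpM2r ?expR_ge0 //.
have step (a : 'I_b) : expR (s * D a) <= rho + s * D a.
  have Db : `|D a| <= c by exact: vdc_incr_bound (vdc_itv R b n b1).
  have sDb : `|s * D a| <= `|s| * c by rewrite normrM ler_wpM2l.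
  have sD2 : (s * D a) ^+ 2 <= (s * c) ^+ 2.
    rewrite -(real_normK (num_real (s * D a))) -(real_normK (num_real (s * c))).
    by rewrite lerXn2r ?nnegrE // [leRHS]normrM (ger0_norm c_ge0).
  apply: le_trans (expR_quadratic R _ _) _.
    by apply: le_trans (ler_norm _) _; apply: le_trans sDb _; move: s_small; rewrite /c; lra.
  by rewrite /rho; lra.
apply: le_trans (ler_sum _ (fun a _ => step a)) _.
rewrite big_split /= -mulr_sumr (vdc_incr_sum R b _ b1) mulr0 addr0.
by rewrite sumr_const card_ord mulr_natl.
Qed.

(* The correction [- 2 q ^ k] absorbs the incomplete last block of each scale. *)
Lemma vdc_expR_sum k M : (b ^ k <= M < b ^ k.+1)%N ->
  \sum_(n < M) w k.+1 n <=
  expR (`|s| / 4) * rho ^+ k.+1 * (4 * M%:R - 2 * q ^+ k.+1).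
Proof.
have e0 : 0 <= expR (`|s| / 4) by exact: expR_ge0.
have b0 : (0 < b)%N := ltnW b1.
have B2 : 2 <= b%:R :> R by rewrite (ler_nat _ 2).
elim: k M => [|k IH] M /andP[kM Mk].
  have M1 : 1 <= M%:R :> R by rewrite (ler_nat _ 1).
  apply: le_trans (_ : \sum_(n < M) expR (`|s| / 4) * q <= _).
    apply: ler_sum => n _; rewrite -[q]expr1; apply: vdc_expR_sup.
    exact: ltn_trans Mk.
  rewrite sumr_const card_ord -[leLHS]mulr_natl !expr1 mulrCA -mulrA ler_wpM2l //.
  (* As [M >= 1] and [q <= 4/3], [M q + 2 q <= 3 M q <= 4 M]. *)
  apply: le_trans (_ : 4 * M%:R - 2 * q <= _); first by have := q_le; nra.
  rewrite ler_peMl //; have := q_le; lra.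
(* The [Q] complete blocks are handled by induction, the [r] leftover terms by the worst-case
   bound. *)
set Q := (M %/ b)%N; set r := (M %% b)%N.
have ME : M = (b * Q + r)%N by rewrite /Q /r mulnC -divn_eq.
have rb : (r < b)%N by rewrite ltn_pmod.
have QM : (b ^ k <= Q < b ^ k.+1)%N.
  by rewrite /Q leq_divRL // ltn_divLR // -!expnSr kM.
have := IH _ QM; set E := expR _ => GQ.
have rhok : 1 <= rho ^+ k.+2 by rewrite exprn_ege1.
have qk : 1 <= q ^+ k.+1 by rewrite exprn_ege1.
have -> : \sum_(n < M) w k.+2 n = \sum_(n < b * Q + r) w k.+2 n by rewrite -ME.
rewrite (sum_nat_block R (w k.+2)).
apply: le_trans (_ : b%:R * rho * (E * rho ^+ k.+1 * (4 * Q%:R - 2 * q ^+ k.+1))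
   + r%:R * (E * q ^+ k.+2) <= _).
  apply: lerD.
    apply: le_trans (ler_sum _ (fun (n : 'I_Q) _ => vdc_expR_sum_block k.+1 n)) _.
    by rewrite -mulr_sumr ler_wpM2l // mulr_ge0 // (le_trans ler01).
  apply: le_trans (_ : \sum_(a < r) E * q ^+ k.+2 <= _).
    apply: ler_sum => a _; apply: vdc_expR_sup.
    by apply: leq_ltn_trans Mk; rewrite ME leq_add2l ltnW.
  by rewrite sumr_const card_ord mulr_natl.
have -> : M%:R = b%:R * Q%:R + r%:R :> R by rewrite {1}ME natrD natrM.
have r1 : r%:R + 1 <= b%:R :> R by rewrite natr1 ler_nat.
have r0 : 0 <= r%:R :> R by [].
(* The leftover fits into the gain [2 b q^(k+1) - 2 q^(k+2)] of the correction, since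
   [(r + 2) q <= 4 (b + 1) / 3 <= 2 b]. *)
have key : r%:R * q ^+ k.+2 <=
    rho ^+ k.+2 * (4 * r%:R + 2 * b%:R * q ^+ k.+1 - 2 * q ^+ k.+2).
  have h : r%:R * q <= 2 * b%:R - 2 * q :> R by have := q_le; have := q_ge1; nra.
  have h2 : r%:R * q ^+ k.+2 <= 2 * b%:R * q ^+ k.+1 - 2 * q ^+ k.+2.
    rewrite exprS mulrA; nra.
  apply: le_trans (_ : 4 * r%:R + 2 * b%:R * q ^+ k.+1 - 2 * q ^+ k.+2 <= _).
    by lra.
  rewrite ler_peMl //.
  have : 0 <= r%:R * q ^+ k.+2 by rewrite mulr_ge0 // exprn_ge0 // (le_trans ler01).
  lra.
have := ler_wpM2l e0 key; rewrite -/E [rho ^+ k.+2]exprS; nra.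
Qed.

End ExponentialMoment.

(** * Tail bound for the corrected sum *)

(** Markov's inequality applied to [e^(s X) + e^(-s X)], which dominates [e^(s |X|)]. *)
Lemma card_norm_ge_chernoff (R : realType) (T : finType) (X : T -> R) (s t : R) :
  0 <= s ->
  #|[set x | t <= `|X x|]|%:R * expR (s * t) <=
  \sum_x expR (s * X x) + \sum_x expR (- s * X x).
Proof.
move=> s0; rewrite -big_split /= mulr_natl -sumr_const big_mkcond /=.
apply: ler_sum => x _; rewrite inE; case: ifPn => [tX|_]; last first.
  by rewrite addr_ge0 ?expR_ge0.
have [X0|X0] := ger0P (X x).
  apply: le_trans (_ : expR (s * X x) <= _); last by rewrite lerDl expR_ge0.
  by rewrite ler_expR ler_wpM2l // -(ger0_norm X0).
apply: le_trans (_ : expR (- s * X x) <= _); last by rewrite lerDr expR_ge0.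
by rewrite ler_expR mulNr -mulrN ler_wpM2l // -(ltr0_norm X0).
Qed.

Lemma vdcW_tail (R : realType) b k M (u : R) : (1 < b)%N ->
  (b ^ k <= M < b ^ k.+1)%N ->
  #|[set n : 'I_M | u * (b%:R * Num.sqrt k.+1%:R) <=
      `|vdcW R b n - k.+1%:R * vdc_mean R b|]|%:R
  <= 8 * expR (1 / 2 - u / 2) * M%:R.
Proof.
move=> b1 kM; set z := Num.sqrt _.
have b0 : 0 < b%:R :> R := natr_gt0_of_gt1 R b b1.
have B2 : 2 <= b%:R :> R by rewrite (ler_nat _ 2).
have z2 : z ^+ 2 = k.+1%:R by rewrite /z sqr_sqrtr.
have z0 : 0 < z by rewrite /z sqrtr_gt0.
have z1 : 1 <= z by rewrite /z -[leLHS]sqrtr1 ler_sqrt // (ler_nat _ 1).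
(* With this [s] the exponent at the threshold is [u/2], while [rho = 1 + 1/(8 (k+1))] keeps
   [rho^(k+1)] below [e^(1/8)]. *)
pose s : R := (2 * (b%:R * z))^-1.
have s0 : 0 < s by rewrite /s invr_gt0 !mulr_gt0.
have bz : 2 <= b%:R * z by nra.
have s_le : s <= 1 / 4.
  by rewrite /s div1r lef_pV2 ?posrE //; nra.
have sb : s * (b%:R / 2) <= 1 / 4.
  rewrite (_ : s * _ = z^-1 / 4); last first.
    by rewrite /s; field; rewrite !lt0r_neq0.
  rewrite ler_pM2r; last by rewrite invr_gt0.
  by rewrite invf_le1.
have moment (e : R) : `|e| = s ->
    \sum_(n < M) expR (e * (vdcW R b n - k.+1%:R * vdc_mean R b)) <=
    4 * expR (1 / 2) * M%:R.
  move=> es; have e_small : `|e| * (b%:R / 2) <= 1 / 4 by rewrite es.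
  apply: le_trans (vdc_expR_sum R b e b1 e_small k M kM) _; rewrite es.
  have e2 : (e * (b%:R / 2)) ^+ 2 = (16 * k.+1%:R)^-1.
    rewrite exprMn -(real_normK (num_real e)) es -z2 /s; field.
    by rewrite !lt0r_neq0.
  rewrite e2; set rho := 1 + _.
  have rho0 : 0 <= rho by rewrite /rho addr_ge0 // mulr_ge0 // invr_ge0 mulr_ge0.
  have rhok : rho ^+ k.+1 <= expR (1 / 8).
    rewrite (_ : 1 / 8 = k.+1%:R * (2 * (16 * k.+1%:R)^-1)).
      by rewrite expRM_natl lerXn2r ?nnegrE ?expR_ge0 // expR_ge1Dx.
    by field; rewrite addrC natr1 pnatr_eq0.
  apply: le_trans (_ : expR (s / 4) * rho ^+ k.+1 * (4 * M%:R) <= _).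
    apply: ler_wpM2l; first by rewrite mulr_ge0 ?expR_ge0 ?exprn_ge0.
    by rewrite gerBl mulr_ge0 // exprn_ge0 // expR_ge0.
  rewrite mulrCA [leLHS]mulrA ler_wpM2r // ler_wpM2l //.
  apply: le_trans (_ : expR (s / 4) * expR (1 / 8) <= _).
    by rewrite ler_wpM2l ?expR_ge0.
  (* The exponent is at most [1/16 + 1/8]. *)
  by rewrite -expRD ler_expR; lra.
have su : s * (u * (b%:R * z)) = u / 2.
  by rewrite /s; field; rewrite !lt0r_neq0.
have := card_norm_ge_chernoff R 'I_M
  (fun n => vdcW R b n - k.+1%:R * vdc_mean R b) s (u * (b%:R * z)) (ltW s0).
rewrite su expRD expRN -ler_pdivlMr ?expR_gt0 // => H; apply: le_trans H _.
rewrite mulrA [leRHS]mulrAC ler_wpM2r ?invr_ge0 ?expR_ge0 //.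
apply: le_trans (lerD (moment s _) (moment (- s) _)) _.
- by rewrite ger0_norm // ltW.
- by rewrite normrN ger0_norm // ltW.
lra.
Qed.

(** * Comparison with the stated threshold and bound *)

Lemma logb_itv (R : realType) b k M : (1 < b)%N -> (b ^ k <= M < b ^ k.+1)%N ->
  k%:R <= logb b (M%:R : R) <= k.+1%:R.
Proof.
move=> b1 /andP[kM Mk]; have b0 := natr_gt0_of_gt1 R b b1.
have lnb : 0 < ln (b%:R : R) by rewrite ln_gt0 // (ltr_nat _ 1).
have M0 : 0 < M%:R :> R.
  by rewrite ltr0n; apply: leq_trans kM; rewrite expn_gt0 ltnW.
rewrite /logb ler_pdivlMr // ler_pdivrMr // !mulr_natl -!lnXn //.
by rewrite !ler_ln ?posrE ?exprn_gt0 // -!natrX !ler_nat kM ltnW.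
Qed.

Lemma expR_tail_le (R : realType) (lambda : R) : 3 <= lambda ->
  8 * expR (1 / 2 - 12 * lambda) <=
  4 * Num.sqrt lambda / (expR (Num.sqrt lambda - 1) - 2).
Proof.
move=> l3; set z := Num.sqrt lambda.
have z2 : z ^+ 2 = lambda by rewrite sqr_sqrtr //; lra.
have z0 : 0 <= z by exact: sqrtr_ge0.
have z1 : 1732 / 1000 <= z by nra.
have den0 : 2 < expR (z - 1).
  (* Here [(z - 1) / 8 >= 0.0915], and [1.0915^8 > 2]. *)
  rewrite (_ : z - 1 = 8%:R * ((z - 1) / 8)); last by field.
  apply: lt_le_trans (_ : (10915 / 10000) ^+ 8 <= _); first by lra.
  rewrite expRM_natl lerXn2r ?nnegrE ?expR_ge0 //; first by lra.
  by apply: le_trans (expR_ge1Dx _); lra.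
apply: le_trans (_ : 4 * z / expR (z - 1) <= _); last first.
  rewrite ler_wpM2l //; first by lra.
  by rewrite lef_pV2 ?posrE ?expR_gt0 //; lra.
rewrite ler_pdivlMr ?expR_gt0 // -mulrA -expRD.
(* An exponent of at most -1 suffices, because [e^x <= 1/(1 - x)]. *)
have h : expR (1 / 2 - 12 * lambda + (z - 1)) <= 1 / 2.
  apply: le_trans (expR_le_inv R _ _) _; first by nra.
  by rewrite div1r lef_pV2 ?posrE //; nra.
lra.
Qed.

Theorem theorem2 (R : realType) (b M : nat) (lambda : R)
    (hb : (2 <= b)%N) (hM : (b < M)%N) (hlambda : 3 <= lambda) :
  1 / M%:R *
    #|[set N : 'I_M |
        `|vdcS R b N - (b%:R ^+ 2 - 1) / (12 * b%:R) * logb b (M%:R : R)|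
          >= 25 * lambda * b%:R * Num.sqrt (logb b (M%:R : R) + 1)]|%:R
  <= 4 * Num.sqrt lambda / (expR (Num.sqrt lambda - 1) - 2)
     + 1 / (b%:R `^ (Num.sqrt (logb b (M%:R : R)) - 2)).
Proof.
have M0 : (0 < M)%N by exact: leq_ltn_trans hM.
have kM := trunc_log_bounds hb M0; set k := trunc_log b M in kM.
have /andP[kL Lk] := logb_itv R b k M hb kM.
rewrite -/(vdc_mean R b); set L := logb b _ in kL Lk *.
apply: le_trans (_ : 4 * Num.sqrt lambda / (expR (Num.sqrt lambda - 1) - 2) <= _);
  last by rewrite lerDl divr_ge0 // powR_ge0.
apply: le_trans (expR_tail_le R lambda hlambda).
rewrite mulrC mulrA mulr1 ler_pdivrMr ?ltr0n //.
(* Of the constant 25, one unit is kept to pay for passing from [vdcS] and [L] to [vdcW] and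
   [k+1]. *)
have := vdcW_tail R b k M (24 * lambda) hb kM.
rewrite (_ : 24 * lambda / 2 = 12 * lambda); last by field.
apply: le_trans; rewrite ler_nat; apply/subset_leq_card/subsetP => n.
rewrite !inE; set z := Num.sqrt (L + 1); set y := Num.sqrt _ => Hn.
have B2 : 2 <= b%:R :> R by rewrite (ler_nat _ 2).
have y1 : 1 <= y by rewrite /y -[leLHS]sqrtr1 ler_sqrt // (ler_nat _ 1).
have L0 : 0 <= L by exact: le_trans kL.
have yz : y <= z.
  by rewrite /y /z ler_sqrt ?addr_ge0 //; move: kL; rewrite -natr1; lra.
have mu0 : 0 <= vdc_mean R b by rewrite /vdc_mean divr_ge0 ?mulr_ge0 //; nra.
have mub : vdc_mean R b <= b%:R / 12 by rewrite /vdc_mean ler_pdivrMr; nra.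
have /andP[x0 x1] := vdc_itv R b n hb.
(* Replacing [L] by [k+1] costs at most [b/12], and the correction at most [1/4 <= b/8]. *)
have dist : `|vdcS R b n - vdc_mean R b * L| <=
    `|vdcW R b n - k.+1%:R * vdc_mean R b| + b%:R / 4.
  rewrite -[X in `|X|](_ : (vdcW R b n - k.+1%:R * vdc_mean R b) +
    (vdc_mean R b * (k.+1%:R - L) - (1 / 2 - vdc R b n) / 2) = _); last first.
    by rewrite /vdcW; ring.
  apply: le_trans (ler_normD _ _) _; rewrite lerD2l.
  have Lk1 : 0 <= k.+1%:R - L <= 1 by rewrite -natr1; apply/andP; split; lra.
  have : 0 <= vdc_mean R b * (k.+1%:R - L) <= vdc_mean R b.
    by case/andP: Lk1 => ? ?; apply/andP; split; nra.
  by case/andP=> ? ?; rewrite ler_norml; apply/andP; split; lra.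
(* The reserved unit is at least [3 b], more than the cost [b/4]. *)
have ly : 3 * 1 <= lambda * y by apply: ler_pM => //; lra.
have lyz : lambda * y <= lambda * z by rewrite ler_wpM2l //; lra.
have h1 : b%:R * 3 <= b%:R * (lambda * y) by rewrite ler_wpM2l //; lra.
have h2 : b%:R * (lambda * y) <= b%:R * (lambda * z) by rewrite ler_wpM2l //; lra.
have := le_trans Hn dist; lra.
Qed.
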